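(* Every trajectory $t\mapsto P(t)$ of the differential inclusion $$\dot P \in -\mathsf{L}\,\partial f^{\epsilon}(P) + \frac1n\,(P_l - \mathbf{1}_n^\top P)\,\mathbf{1}_n ,$$ starting from any point $P(0)\in\mathbb{R}^n$, converges (as $t\to\infty$) to the set $\mathcal{F}_{\mathrm{ED}}^*$ of solutions of the economic dispatch problem $$\text{minimize } f(P)\quad\text{subject to}\quad \mathbf{1}_n^\top P = P_l,\quad P^m\le P\le P^M .$$
   Context: Notation: $\mathbf{1}_n=(1,\dots,1)\in\mathbb{R}^n$; $[u]^+=\max\{0,u\}$; vector inequalities are componentwise; $\|\cdot\|_\infty$ is the $\infty$-norm. Graph. $\mathcal{G}=(\mathcal{V},\mathcal{E},\mathsf{A})$ is a weighted digraph with $\mathcal{V}=\{1,\dots,n\}$ and adjacency matrix $\mathsf{A}=(a_{ij})\in\mathbb{R}_{\ge0}^{n\times n}$, with $a_{ij}>0$ iff $(i,j)\in\mathcal{E}$. Its Laplacian is $\mathsf{L}=\mathsf{D}_{\rm out}-\mathsf{A}$, where $\mathsf{D}_{\rm out}$ is diagonal with $(\mathsf{D}_{\rm out})_{ii}=\sum_j a_{ij}$. $\mathcal{G}$ is assumed strongly connected and weight-balanced (i.e., $\sum_j a_{ij}=\sum_j a_{ji}$ for all $i$, equivalently $\mathbf{1}_n^\top\mathsf{L}=0$). Economic dispatch (ED) problem. $f_i:\mathbb{R}\to\mathbb{R}_{\ge0}$, $i\in\{1,\dots,n\}$, are convex and continuously differentiable; $f(P)=\sum_{i=1}^n f_i(P_i)$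 for $P\in\mathbb{R}^n$; $P_l\in\mathbb{R}_{>0}$ is the load; $P^m,P^M\in\mathbb{R}^n$ are the lower and upper limits. The feasible set is $\mathcal{F}_{\mathrm{ED}}=\{P\in\mathbb{R}^n \mid P^m\le P\le P^M,\ \mathbf{1}_n^\top P=P_l\}$, assumed nonempty, and $\mathcal{F}_{\mathrm{ED}}^*$ is the set of minimizers of $f$ over $\mathcal{F}_{\mathrm{ED}}$. It is assumed that $P^m\notin\mathcal{F}_{\mathrm{ED}}$ and $P^M\notin\mathcal{F}_{\mathrm{ED}}$. Penalized cost. $f^{\epsilon}(P)=\sum_{i=1}^n f_i(P_i)+\frac1\epsilon\sum_{i=1}^n\big([P_i-P_i^M]^+ + [P_i^m-P_i]^+\big)$, where $\epsilon>0$ satisfies $\epsilon<\dfrac{1}{2\max_{P\in\mathcal{F}_{\mathrm{ED}}}\|\nabla f(P)\|_\infty}$. $\partial f^\epsilon$ denotes the (Clarke) generalized gradient, and $-\mathsf{L}\,\partial f^\epsilon(P)=\{-\mathsf{L}\zeta\mid\zeta\in\partial f^\epsilon(P)\}$. Trajectories are solutions of the differential inclusion on $[0,\infty)$, i.e., locally absolutely continuous maps satisfying it for almost all $t\ge0$. Convergence to a set means that the distance to the set tends to $0$. *)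

(* Defs.v *)
From mathcomp Require Import all_boot all_order all_algebra.
From mathcomp Require Import all_classical all_reals all_analysis.
Import Order.TTheory GRing.Theory Num.Theory.
Import numFieldNormedType.Exports.

Set Implicit Arguments.
Unset Strict Implicit.
Unset Printing Implicit Defensive.

Local Open Scope classical_set_scope.
Local Open Scope ring_scope.

(* Vectors of R^n are column matrices 'cV[R]_n; their norm `|x| is the
   infinity norm. *)

Section Graph.
Context {R : realType} {n : nat}.
Implicit Types A : 'M[R]_n.

Definition edge A : rel 'I_n := [rel i j | 0 < A i j].

Definition strongly_connected A := forall i j, connect (edge A) i j.

Definition weight_balanced A :=
  forall i, \sum_(j < n) A i j = \sum_(j < n) A j i.

Definition laplacian A : 'M[R]_n := diag_mx (\row_i \sum_(j < n) A i j) - A.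

End Graph.

Section Nonsmooth.
Context {R : realType} {n : nat}.
Implicit Types (F : 'cV[R]_n -> R) (x : 'cV[R]_n).

Definition gradient F x : 'cV[R]_n := \col_i 'D_(delta_mx i 0) F x.

Definition limiting_gradients F x : set 'cV[R]_n :=
  [set z | exists u : nat -> 'cV[R]_n,
    [/\ forall k, differentiable F (u k),
        u k @[k --> \oo] --> x
      & gradient F (u k) @[k --> \oo] --> z]].

(* Clarke's generalized gradient of a locally Lipschitz function is the convex
   hull of the limits of gradients taken along sequences of points of
   differentiability.  The sequences may also be required to avoid a given
   Lebesgue-null set, whose choice is immaterial; it is empty here. *)
Definition generalized_gradient F x : set 'cV[R]_n :=
  smallest (@convex_set R 'cV[R]_n) (limiting_gradients F x).

End Nonsmooth.

Section Trajectories.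
Context {R : realType}.

Definition abs_continuous_on {V : normedModType R} (a b : R) (g : R -> V) :=
  forall e : R, 0 < e -> exists2 d : R, 0 < d &
    forall (m : nat) (u v : 'I_m -> R),
      (forall k, [/\ a <= u k, u k <= v k & v k <= b]) ->
      trivIset setT (fun k => `]u k, v k[%classic) ->
      \sum_(k < m) (v k - u k) < d ->
      \sum_(k < m) `|g (v k) - g (u k)| < e.

(* The values of P at negative times are irrelevant: the two-sided derivative
   only matters at almost every t >= 0, hence only at t > 0. *)
Definition is_trajectory {V : normedModType R} (Phi : V -> set V)
    (P : R -> V) :=
  (forall a b : R, 0 <= a -> abs_continuous_on a b P) /\
  {ae @lebesgue_measure R, forall t : R, 0 <= t ->
     derivable P t 1 /\ Phi (P t) (derive1 P t)}.

End Trajectories.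

Section EconomicDispatch.
Context {R : realType} {n : nat}.
Implicit Types (f : 'I_n -> R -> R) (P Pm PM : 'cV[R]_n) (Pl eps : R).

Definition total_cost f P : R := \sum_(i < n) f i (P i 0).

Definition feasible Pm PM Pl : set 'cV[R]_n :=
  [set P | (forall i, Pm i 0 <= P i 0 <= PM i 0) /\
           \sum_(i < n) P i 0 = Pl].

Definition ED_solutions f Pm PM Pl : set 'cV[R]_n :=
  [set P | feasible Pm PM Pl P /\
           forall Q, feasible Pm PM Pl Q -> total_cost f P <= total_cost f Q].

Definition penalized_cost f Pm PM eps P : R :=
  \sum_(i < n) f i (P i 0) +
  eps^-1 * \sum_(i < n) (Num.max 0 (P i 0 - PM i 0) +
                         Num.max 0 (Pm i 0 - P i 0)).

(* The supremum is a maximum: the feasible set is compact and the gradient of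
   the cost is continuous. *)
Definition max_gradient_norm f Pm PM Pl : R :=
  sup [set `|gradient (total_cost f) P| | P in feasible Pm PM Pl].

Definition dispatch_field (A : 'M[R]_n) f Pm PM Pl eps P : set 'cV[R]_n :=
  [set - (laplacian A *m z) +
       (n%:R^-1 * (Pl - \sum_(i < n) P i 0)) *: const_mx 1
  | z in generalized_gradient (penalized_cost f Pm PM eps) P].

End EconomicDispatch.

(* Main.v *)
Require Import Defs.
From mathcomp Require Import all_boot all_order all_algebra.
From mathcomp Require Import all_classical all_reals all_analysis.
From mathcomp Require Import measurable_realfun ring lra.
Import Order.TTheory GRing.Theory Num.Theory.
Import numFieldNormedType.Exports.

Set Implicit Arguments.
Unset Strict Implicit.
Unset Printing Implicit Defensive.

Local Open Scope classical_set_scope.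
Local Open Scope ring_scope.

(* The penalized cost F is a sum of convex functions of one variable, so the
   elements of its generalized gradient are convex subgradients.  Along a
   trajectory with dP/dt = - L z + ((Pl - s) / n) 1, where s is the sum of the
   coordinates, |Pl - s| decreases at rate |Pl - s|, and F decreases at rate at
   least z^T L z up to a term that vanishes with Pl - s.  Since L is the
   Laplacian of a strongly connected balanced graph, z^T L z controls the
   differences z_i - z_j, hence also the pairing <z, P - Q> up to that same
   error; and this pairing dominates F(P) - F(Q) for a solution Q.  So F
   decreases at a definite rate as long as F(P) - F(Q) >= eta, without any
   appeal to LaSalle's principle.  Exactness of the penalty and compactness turn
   the limits F(P) -> F(Q) and s -> Pl into convergence to the solutions.

   F(P(t)) need not be differentiated: the subgradient inequality bounds its
   upper left Dini derivative, which is enough for an absolutely continuous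
   function to decrease. *)

(** * Absolutely continuous functions and left Dini derivatives *)

Section LeftDini.
Context {R : realType}.
Implicit Types (g : R -> R) (a b c : R).

(** Taken from the left because a subgradient at [P t] bounds [F (P t) - F (P (t - h))] from above;
    to the right of [t] it would only bound the increment from below. *)
Definition left_dini_le g t c := forall e, 0 < e -> exists2 d, 0 < d &
  forall h, 0 < h < d -> g t - g (t - h) <= (c + e) * h.

Lemma abs_continuous_on_uniform {V : normedModType R} (g : R -> V) a b :
  abs_continuous_on a b g -> forall e, 0 < e -> exists2 d, 0 < d &
    forall x y, a <= x -> x <= y -> y <= b -> y - x < d -> `|g y - g x| < e.
Proof.
move=> acg e /acg[d d0 Hd]; exists d => // x y ax xy yb yx.
have := Hd 1%N (fun=> x) (fun=> y); rewrite !big_ord1; apply => //.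
by move=> i j _ _ _; rewrite !ord1.
Qed.

Lemma sum_itv_length_le m (u v : 'I_m -> R) (U : set R) :
  measurable U -> (forall k, u k <= v k) ->
  (forall k, `]u k, v k[ `<=` U) ->
  trivIset setT (fun k => `]u k, v k[%classic) ->
  ((\sum_(k < m) (v k - u k))%:E <= lebesgue_measure U)%E.
Proof.
move=> mU uv uvU tuv.
have -> : (\sum_(k < m) (v k - u k))%:E =
    lebesgue_measure (\big[setU/set0]_(k < m) `]u k, v k[%classic : set R).
  rewrite measure_bigsetU_ord// -sumEFin.
  apply: eq_bigr => k _.
  rewrite [RHS](@lebesgue_measure_itv R `]u k, v k[%R)/=.
  rewrite lte_fin; case: ltP => // vu.
  have -> : v k = u k by apply/eqP; rewrite eq_le vu uv.
  by rewrite subrr.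
apply: le_measure; rewrite ?inE//; first exact: bigsetU_measurable.
by elim/big_ind: _ => // A B AU BU x [/AU|/BU].
Qed.

(** Covers Lipschitz images ([L = 0]) as well as the subtraction of a linear function ([L] its
    absolute slope). *)
Lemma abs_continuous_on_dominated {V W : normedModType R} (g : R -> V)
    (h : R -> W) a b K L : 0 <= K -> 0 <= L ->
  (forall x y, a <= x -> x <= y -> y <= b ->
    `|h y - h x| <= K * `|g y - g x| + L * (y - x)) ->
  abs_continuous_on a b g -> abs_continuous_on a b h.
Proof.
move=> K0 L0 hg acg e e0.
have K1 : 0 < 2 * (K + 1) by rewrite mulr_gt0// ltr_wpDl.
have L1 : 0 < 2 * (L + 1) by rewrite mulr_gt0// ltr_wpDl.
have [d d0 Hd] := acg _ (divr_gt0 e0 K1).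
exists (Num.min d (e / (2 * (L + 1)))); first by rewrite lt_min d0 divr_gt0.
move=> m u v uv tuv; rewrite lt_min => /andP[suv1 suv2].
have {Hd} := Hd m u v uv tuv suv1.
rewrite ltr_pdivlMr// in suv2; rewrite ltr_pdivlMr// => sg.
apply: (@le_lt_trans _ _ (K * \sum_(k < m) `|g (v k) - g (u k)| +
    L * \sum_(k < m) (v k - u k))).
  rewrite !mulr_sumr -big_split/=; apply: ler_sum => k _.
  by have [? ? ?] := uv k; exact: hg.
have : 0 <= \sum_(k < m) `|g (v k) - g (u k)| by apply: sumr_ge0.
have : 0 <= \sum_(k < m) (v k - u k).
  by apply: sumr_ge0 => k _; rewrite subr_ge0; have [] := uv k.
move: (\sum_(k < m) (v k - u k)) (\sum_(k < m) `|_|) suv2 sg => Y X.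
by move=> H1 H2 H3 H4; nra.
Qed.

(* Descending real induction: off the null set, cover it by an open set [U]
   of small measure and pay for the intervals inside [U] with the variation
   of [g] on them, which absolute continuity makes small. *)
Lemma left_dini_nonincreasing g a b (N : set R) : a <= b ->
  abs_continuous_on a b g -> (@lebesgue_measure R).-negligible N ->
  (forall t, a < t <= b -> ~ N t -> left_dini_le g t 0) ->
  g b <= g a.
Proof.
move=> ab acg [N' [mN' N'0 NN']] dini.
rewrite -subr_le0; apply/ler_addgt0Pr => e0 e0_gt0; rewrite add0r.
have ba1 : 0 < b - a + 1 by rewrite ltr_wpDl// subr_ge0.
(* The slope error [e * (b - a)] and the variation [e] allowed inside [U] add up to [e0]. *)
pose e := e0 / (b - a + 1).
have e_gt0 : 0 < e by rewrite divr_gt0.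
suff : g b - g a <= e * (b - a) + e.
  move=> /le_trans; apply.
  by rewrite -[X in _ + X]mulr1 -mulrDr divfK// gt_eqF.
have [d d_gt0 acgd] := acg e e_gt0.
have [|U [oU N'U mUN']] := lebesgue_regularity_outer mN' _ d_gt0.
  by rewrite [X in (X < _)%E]N'0.
have mU : measurable U by exact: open_measurable.
have muU : (lebesgue_measure U < d%:E)%E.
  apply: le_lt_trans mUN'.
  rewrite -[leRHS]adde0 -[X in (_ + X)%E]N'0.
  have mD : measurable (U `\` N') by exact: measurableD.
  apply: le_trans (measureU2 (@lebesgue_measure R) mD mN').
  apply: le_measure; rewrite ?inE//; first exact: measurableU.
  by move=> x Ux; have [N'x|N'x] := pselect (N' x); [right|left].
(* Variations of [g] over families of disjoint open intervals lying in [U], with endpoints in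
   [[x, b]]. Their total length is below [d], so the supremum [W x] is at most [e]; it is the budget
   for crossing points of [N]. *)
pose T x := [set s | exists m (u v : 'I_m -> R),
  [/\ forall k, [/\ x <= u k, u k <= v k & v k <= b],
      forall k, `]u k, v k[ `<=` U,
      trivIset setT (fun k => `]u k, v k[%classic)
    & s = \sum_(k < m) `|g (v k) - g (u k)|]].
have T_lt x s : a <= x -> T x s -> s < e.
  move=> ax [m [u [v [uv uvU tuv ->]]]]; apply: acgd => //.
    by move=> k; have [xu -> ->] := uv k; split=> //; exact: le_trans xu.
  rewrite -lte_fin; apply: le_lt_trans muU; apply: sum_itv_length_le => //.
  by move=> k; have [] := uv k.
have T0 x : T x 0.
  by exists 0%N, (fun=> 0), (fun=> 0); split; rewrite ?big_ord0//; case.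
have T_sup x : a <= x -> has_sup (T x).
  by move=> ax; split; [exists 0|exists e => s /(T_lt _ _ ax)/ltW].
pose W x := sup (T x).
have W_le x y s : a <= x -> x <= y -> T y s -> s <= W x.
  move=> ax xy [m [u [v [uv uvU tuv ->]]]]; apply: ub_le_sup.
    by have [] := T_sup x ax.
  exists m, u, v; split=> // k; have [yu -> ->] := uv k.
  by split=> //; exact: le_trans yu.
have W_anti x y : a <= x -> x <= y -> W y <= W x.
  move=> ax xy; apply: ge_sup; first by exists 0.
  by move=> s; exact: W_le.
have W_add x y : a <= x -> x <= y -> y <= b -> `]x, y[ `<=` U ->
    W y + `|g y - g x| <= W x.
  move=> ax xy yb xyU; rewrite -lerBrDr; apply: ge_sup; first by exists 0.
  move=> s [m [u [v [uv uvU tuv ->]]]]; rewrite lerBrDr.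
  (* The interval from [x] to [y] joins the family at index [ord0]. *)
  apply: (W_le x x) => //; pose w z (f : 'I_m -> R) (k : 'I_m.+1) :=
    if unlift ord0 k is Some j then f j else z.
  exists m.+1, (w x u), (w y v); split.
  - move=> k; rewrite /w; case: unliftP => [j _|_] //.
    by have [yu -> ->] := uv j; split=> //; exact: le_trans yu.
  - by move=> k; rewrite /w; case: unliftP => [j _|_].
  - move=> i j _ _; rewrite /w.
    case: unliftP => [i' ->|->]; case: unliftP => [j' ->|->] //=.
    + by move=> /tuv ->.
    + have [yu _ _] := uv i'.
      move=> [r []]/=; rewrite !in_itv/= => /andP[ur _] /andP[_ ry].
      by have := lt_trans (le_lt_trans yu ur) ry; rewrite ltxx.
    + have [yu _ _] := uv j'.
      move=> [r []]/=; rewrite !in_itv/= => /andP[_ ry] /andP[ur _].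
      by have := lt_trans (le_lt_trans yu ur) ry; rewrite ltxx.
  - rewrite big_ord_recl/= addrC {1 2}/w unlift_none; congr (_ + _).
    by apply: eq_bigr => k _; rewrite /w liftK.
have [Wb0 Wa] : 0 <= W b /\ W a <= e.
  split; first by apply: (W_le b b).
  by apply: ge_sup; [exists 0|move=> s /(T_lt _ _ (lexx a))/ltW].
pose S := [set x | a <= x <= b /\ g b - g x <= e * (b - x) + W x].
have Sb : S b by split; [rewrite ab/=|rewrite !subrr mulr0 add0r].
have S_inf : has_inf S by split; [exists b|exists a => x [/andP[]]].
pose x0 := inf S.
have ax0 : a <= x0 by apply: lb_le_inf; [exists b|move=> x [/andP[]]].
have x0b : x0 <= b by apply: ge_inf => //; case: S_inf.
(* [S] contains its infimum: [g] is continuous, and for [W] monotonicity is enough. *)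
have Sx0 : S x0.
  split; first by rewrite ax0.
  apply/ler_addgt0Pr => r r_gt0.
  have [d1 d1_gt0 Hd1] :=
    abs_continuous_on_uniform acg (divr_gt0 r_gt0 (ltr0n R 2)).
  have ce1 : 0 < `|e| + 1 by rewrite ltr_wpDl.
  have d2_gt0 : 0 < Num.min d1 (r / 2 / (`|e| + 1)).
    by rewrite lt_min d1_gt0/= !divr_gt0.
  have [y [/andP[ay yb] Sy] ylt] := inf_adherent d2_gt0 S_inf.
  have x0y : x0 <= y by apply: ge_inf; [case: S_inf|split=> //; apply/andP].
  have /andP[yx0 yx0'] : (y - x0 < d1) && (y - x0 < r / 2 / (`|e| + 1)).
    by rewrite -lt_min ltrBlDl.
  have gy := Hd1 x0 y ax0 x0y yb yx0.
  have Wy := W_anti x0 y ax0 x0y.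
  have cey : `|e * (y - x0)| < r / 2.
    rewrite normrM (ger0_norm (_ : 0 <= y - x0)) ?subr_ge0//.
    rewrite ltr_pdivlMr// in yx0'; apply: le_lt_trans yx0'.
    by rewrite mulrC ler_wpM2l ?subr_ge0// lerDl.
  move: gy cey; rewrite !ltr_norml => /andP[g1 g2] /andP[c1 c2]; nra.
suff <- : x0 = a.
  by case: Sx0 => _ /le_trans; apply; rewrite lerD2l (le_trans _ Wa)// W_anti.
apply/eqP; apply: contrapT => /negP; rewrite neq_lt ltNge ax0/= => ax0'.
(* A step to the left that stays in [S] contradicts the infimum. At a point of [N] it is paid by
   [W], elsewhere by the Dini bound. *)
suff [x [ax xx0 Cx]] : exists x, [/\ a <= x, x < x0 &
    g x0 - g x + W x0 <= e * (x0 - x) + W x].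
  have : S x.
    split; first by rewrite ax (le_trans (ltW xx0)).
    by case: Sx0 => _; lra.
  by move=> /(@ge_inf _ _ S_inf.2); rewrite leNgt xx0.
have [Nx0|Nx0] := pselect (N x0).
  have /nbhs_ballP[r/= r_gt0 rU] : nbhs x0 U.
    by apply: open_nbhs_nbhs; split=> //; apply: N'U; exact: NN'.
  pose x := Num.max a (x0 - r).
  have ax : a <= x by rewrite le_max lexx.
  have xx0 : x < x0 by rewrite gt_max ax0'/= ltrBlDr ltrDl.
  have xr : x0 - r <= x by rewrite le_max lexx orbT.
  exists x; split=> //.
  have : W x0 + `|g x0 - g x| <= W x.
    apply: W_add => //; first exact: ltW.
    move=> z/=; rewrite in_itv/= => /andP[xz zx0]; apply: rU.
    by rewrite /ball/= ger0_norm ?subr_ge0 ?(ltW zx0)//; lra.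
  have := ler_norm (g x0 - g x).
  have : 0 <= e * (x0 - x) by rewrite mulr_ge0 ?subr_ge0// ltW.
  lra.
have [|d1 d1_gt0 Hd1] := dini x0 _ Nx0 e e_gt0; first by rewrite ax0'.
pose h := Num.min (d1 / 2) (x0 - a).
have h_gt0 : 0 < h by rewrite lt_min divr_gt0//= subr_gt0.
have hd1 : h < d1 by rewrite gt_min ltr_pdivrMr// ltr_pMr// ltr1n.
have ha : h <= x0 - a by rewrite ge_min lexx orbT.
exists (x0 - h); split; [lra|lra|].
have := Hd1 h; rewrite h_gt0 hd1 => /(_ isT).
have -> : 0 + e = e by rewrite add0r.
have : W x0 <= W (x0 - h) by apply: W_anti; lra.
lra.
Qed.

Lemma left_dini_increment g a b c (N : set R) : a <= b ->
  abs_continuous_on a b g -> (@lebesgue_measure R).-negligible N ->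
  (forall t, a < t <= b -> ~ N t -> left_dini_le g t c) ->
  g b - g a <= c * (b - a).
Proof.
move=> ab acg N0 dini; pose h t := g t - c * t.
suff : h b <= h a by rewrite /h; lra.
apply: (left_dini_nonincreasing ab _ N0).
  apply: (@abs_continuous_on_dominated _ _ g h a b 1 `|c|) => //.
  move=> x y _ xy _; rewrite mul1r /h.
  have -> : g y - c * y - (g x - c * x) = (g y - g x) - c * (y - x) by ring.
  apply: le_trans (ler_normB _ _) _.
  by rewrite normrM (@ger0_norm _ (y - x)) ?subr_ge0.
move=> t tab Nt e e0; have [d d0 Hd] := dini t tab Nt e e0.
exists d => // s sd; have := Hd s sd; rewrite /h; lra.
Qed.

(** The truncation [max (g, c)] is nonincreasing, so [g] stays below [c] once it has come there; and
    it must come there, as it would otherwise decrease at rate [kappa] forever. *)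
Lemma barrier g T c (kappa : R) (N : set R) : 0 < kappa ->
  (forall b, abs_continuous_on T b g) -> (@lebesgue_measure R).-negligible N ->
  (forall t, T < t -> ~ N t -> c <= g t -> left_dini_le g t (- kappa)) ->
  \forall t \near +oo, g t <= c.
Proof.
move=> k0 acg N0 dini.
pose m t := Num.max (g t) c.
have m_anti a b : T <= a -> a <= b -> m b <= m a.
  move=> Ta ab; apply: (left_dini_nonincreasing ab _ N0).
    have acab : abs_continuous_on a b g.
      move=> e /(acg b)[d d0 Hd]; exists d => // n u v uv; apply: Hd => k.
      by have [au -> ->] := uv k; split=> //; exact: le_trans au.
    apply: (@abs_continuous_on_dominated _ _ g m a b 1 0) => //.
    move=> x y _ _ _; rewrite mul1r mul0r addr0 /m.
    have := ler_norm (g y - g x); have := lerNnormlW (lexx `|g y - g x|).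
    rewrite ler_norml => ? ?; apply/andP.
    by case: (leP (g y) c) => ?; case: (leP (g x) c) => ?; split; lra.
  move=> t /andP[at_ tb] Nt e e0; have [gt|gt] := leP c (g t).
    have [d d0 Hd] := dini t (le_lt_trans Ta at_) Nt gt e e0.
    exists d => // h hd; have := Hd h hd; rewrite /m (max_l gt).
    have : 0 < kappa * h by rewrite mulr_gt0//; case/andP: hd.
    by case: (leP (g (t - h)) c) => ?; lra.
  exists 1 => // h /andP[h0 _]; rewrite /m (max_r (ltW gt)).
  have : 0 < e * h by rewrite mulr_gt0.
  by case: (leP (g (t - h)) c) => ?; lra.
have [t0 Tt0 gt0] : exists2 t, T <= t & g t <= c.
  apply: contrapT => /forall2NP gc.
  have {}gc t : T <= t -> c < g t.
    by move=> Tt; have [//|/negP] := gc t; rewrite -ltNge.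
  (* The time by which a decrease at rate [kappa] brings [g] down to [c]. *)
  pose b := T + (g T - c) / kappa.
  have Tb : T <= b by rewrite lerDl divr_ge0 ?subr_ge0 ?(ltW (gc _ _))// ltW.
  have : g b - g T <= - kappa * (b - T).
    apply: (left_dini_increment Tb (acg b) N0) => t /andP[Tt _] Nt.
    by apply: dini => //; rewrite ltW// gc// ltW.
  have -> : - kappa * (b - T) = c - g T.
    by rewrite /b addrAC subrr add0r mulNr mulrC divfK ?gt_eqF// opprB.
  by have := gc b Tb; lra.
near=> t; have : m t <= m t0.
  by apply: m_anti => //; near: t; exact: nbhs_pinfty_ge.
by rewrite /m [leRHS]max_r// ge_max => /andP[].
Unshelve. all: end_near. Qed.

End LeftDini.

(** * Subgradients and generalized gradients *)

Lemma derivable_littleo {R : realType} {V W : normedModType R} (f : V -> W)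
    (x v : V) : derivable f x v -> forall e, 0 < e ->
  exists2 d : R, 0 < d & forall h, `|h| < d ->
    `|f (h *: v + x) - f x - h *: 'D_v f x| <= e * `|h|.
Proof.
move=> df e e0; move/cvgrPdist_lt/(_ e e0)/nbhs_ballP: df => [d d0 Hd].
exists d => // h hd; have [->|h0] := eqVneq h 0.
  by rewrite !scale0r add0r !subrr !normr0 mulr0.
have := Hd h _ h0; rewrite /ball/= sub0r normrN => /(_ hd).
rewrite -/(derive f x v) -normrN opprB => /ltW Hh.
have -> : f (h *: v + x) - f x - h *: 'D_v f x =
    h *: (h^-1 *: (f (h *: v + x) - f x) - 'D_v f x).
  by rewrite scalerBr scalerA divff// scale1r.
by rewrite normrZ mulrC ler_wpM2r.
Qed.

Section Subgradient.
Context {R : realType} {n : nat}.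
Implicit Types (F : 'cV[R]_n -> R) (x y z : 'cV[R]_n).

Definition subgradient F x : set 'cV[R]_n :=
  [set z | forall y, F x + \sum_i z i 0 * (y i 0 - x i 0) <= F y].

Lemma coord_le_norm x i : `|x i 0| <= `|x|.
Proof.
rewrite [leRHS]/Num.Def.normr/= mx_normrE.
by apply: (le_bigmax _ _ (i, 0 : 'I_1)).
Qed.

Lemma normcV_le x (r : R) : 0 <= r -> (forall i, `|x i 0| <= r) -> `|x| <= r.
Proof.
move=> r0 xr; rewrite [leLHS]/Num.Def.normr/= mx_normrE; apply/bigmax_leP.
by split=> // -[i j] _ /=; rewrite ord1.
Qed.

(** Positive steps along the axis give difference quotients at least [z i 0], negative steps give
    quotients at most [z i 0]. *)
Lemma subgradient_derive F x z i : subgradient F x z ->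
  derivable F x (delta_mx i 0) -> 'D_(delta_mx i 0) F x = z i 0.
Proof.
move=> Fz dF; set D := 'D_(_) F x.
have zle h : h * z i 0 <= F (h *: delta_mx i 0 + x) - F x.
  rewrite lerBrDl; apply: le_trans (Fz _); rewrite lerD2l.
  rewrite (bigD1 i)//= big1 ?addr0 => [|j ji].
    by rewrite !mxE !eqxx mulr1 addrK mulrC.
  by rewrite !mxE (negbTE ji)/= mulr0 add0r subrr mulr0.
have small e : 0 < e -> `|D - z i 0| <= e.
  move=> e0; have [d d0 Hd] := derivable_littleo dF e0.
  have hd0 : 0 < d / 2 by rewrite divr_gt0.
  have hd : d / 2 < d by rewrite ltr_pdivrMr// ltr_pMr// ltr1n.
  have := Hd (d / 2); have := Hd (- (d / 2)); rewrite normrN gtr0_norm//.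
  move=> /(_ hd) + /(_ hd); rewrite !ler_norml !/(_ *: (_ : R)) -/D.
  move=> /andP[_ +] /andP[_ +].
  have := zle (d / 2); have := zle (- (d / 2)).
  move: (F _ - F x) (F _ - F x) => a b; rewrite /GRing.scale/=.
  move=> H1 H2 H3 H4.
  by apply/andP; split; rewrite -(ler_pM2r hd0); lra.
apply/eqP; rewrite -subr_eq0 -normr_le0; apply/ler_addgt0Pr => e /small.
by rewrite add0r.
Qed.

(** Subgradients form a convex set, stable under limits since [F] is continuous. At a point of
    differentiability every subgradient equals the gradient, so the existence of one makes the
    gradient a subgradient. *)
Lemma generalized_gradient_subgradient F x : continuous F ->
  (forall y, subgradient F y !=set0) ->
  generalized_gradient F x `<=` subgradient F x.
Proof.
move=> cF sF; apply: smallest_sub => [a b t|z [u [du ux gz]] y].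
  rewrite !inE => Fa Fb y; have := Fa y; have := Fb y.
  have t0 : 0 <= t%:num by [].
  have t1 : 0 <= 1 - t%:num by rewrite subr_ge0.
  move=> /(ler_wpM2l t1) + /(ler_wpM2l t0); rewrite !mulrDr.
  have -> : \sum_i (conv t a b : 'cV[R]_n) i 0 * (y i 0 - x i 0) =
      t%:num * (\sum_i a i 0 * (y i 0 - x i 0)) +
      (1 - t%:num) * (\sum_i b i 0 * (y i 0 - x i 0)).
    rewrite !mulr_sumr -big_split/=; apply: eq_bigr => i _.
    by rewrite !mxE /unstable.onem; ring.
  by lra.
have Hk k : F (u k) + \sum_i gradient F (u k) i 0 * (y i 0 - u k i 0) <= F y.
  have [w Fw] := sF (u k); apply: le_trans (Fw y); rewrite lerD2l.
  rewrite (eq_bigr (fun i => w i 0 * (y i 0 - u k i 0)))// => i _.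
  by rewrite mxE (subgradient_derive Fw)//; exact: diff_derivable.
have coord (v : nat -> 'cV[R]_n) (l : 'cV[R]_n) i :
    v k @[k --> \oo] --> l -> v k i 0 @[k --> \oo] --> l i 0.
  move=> vl.
  apply: (@continuous_cvg _ _ _ _ _ _ (fun M : 'cV[R]_n => M i 0)) => //.
  exact: coord_continuous.
have Fu : F (u k) @[k --> \oo] --> F x.
  by apply: (@continuous_cvg _ _ _ _ _ _ F) => //; exact: cF.
have Su : \sum_i gradient F (u k) i 0 * (y i 0 - u k i 0) @[k --> \oo] -->
    \sum_i z i 0 * (y i 0 - x i 0).
  apply: cvg_big => [|i _]; first exact: add_continuous.
  by apply: cvgM; [exact: coord|apply: cvgB; [exact: cvg_cst|exact: coord]].
by apply: (cvgr_to_le (cvgD Fu Su)); exact: nearW.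
Qed.

End Subgradient.

(** By uniform continuity [g] changes by less than 1 over a step of length [d / 2], and finitely
    many such steps cover [[a, b]]. *)
Lemma abs_continuous_on_bounded {R : realType} {V : normedModType R}
    (g : R -> V) a b : abs_continuous_on a b g ->
  exists B : R, forall t, a <= t <= b -> `|g t| <= B.
Proof.
move=> /abs_continuous_on_uniform/(_ 1 ltr01)[d d0 Hd].
have step k x : a <= x <= b -> x <= a + k%:R * (d / 2) ->
    `|g x - g a| <= k%:R.
  elim: k x => [|k IH] x /andP[ax xb] xk.
    suff -> : x = a by rewrite subrr normr0.
    by apply/eqP; rewrite eq_le ax -[a]addr0 -[X in a + X](mul0r (d / 2)) xk.
  have [xk'|xk'] := leP x (a + k%:R * (d / 2)).
    by apply: le_trans (IH x _ xk') _; rewrite ?ax ?xb ?ler_nat.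
  set y := _ + _ in xk'.
  have ay : a <= y by rewrite lerDl mulr_ge0// divr_ge0// ltW.
  have yx : x - y < d.
    apply: (@le_lt_trans _ _ (d / 2)); last lra.
    by move: xk; rewrite /y -natr1 mulrDl mul1r; lra.
  rewrite -natr1 -[g x](subrK (g y)) -addrA addrC (le_trans (ler_normD _ _))//.
  rewrite lerD//; last by rewrite ltW// Hd// ltW.
  by apply: IH => //; rewrite ay (le_trans (ltW xk')).
have [k Hk] : exists k, (b - a) / (d / 2) <= k%:R.
  exists (Num.bound `|(b - a) / (d / 2)|).
  by rewrite (le_trans (ler_norm _))// ltW// archi_boundP.
exists (`|g a| + k%:R) => t /andP[at_ tb].
rewrite -[g t](subrK (g a)) addrC (le_trans (ler_normD _ _))// lerD2l.
apply: step; first by rewrite at_.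
by move: Hk; rewrite ler_pdivrMr ?divr_gt0//; lra.
Qed.

(** * Decrease of a function along a trajectory *)

Section Trajectory.
Context {R : realType} {n : nat}.
Implicit Types (F : 'cV[R]_n -> R) (P : R -> 'cV[R]_n).

(** Lipschitz on every ball. A trajectory stays in a ball during a bounded time interval, which
    makes [F \o P] absolutely continuous there. *)
Definition bounded_lipschitz F := forall B, exists2 K, 0 <= K &
  forall x y, `|x| <= B -> `|y| <= B -> `|F y - F x| <= K * `|y - x|.

Lemma subgradient_left_dini F P t z c : derivable P t 1 ->
  subgradient F (P t) z -> \sum_i z i 0 * (derive1 P t) i 0 <= c ->
  left_dini_le (F \o P) t c.
Proof.
move=> dP Fz zc e e0; rewrite derive1E in zc.
(* With this divisor the first-order errors of the coordinates, weighted by [z], add up to at most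
   [e * h]. *)
have S0 : 0 < \sum_i `|z i 0| + 1 by rewrite ltr_wpDl// sumr_ge0.
have [d d0 Hd] := derivable_littleo dP (divr_gt0 e0 S0).
exists d => // h /andP[h0 hd] /=.
have := Hd (- h); rewrite normrN gtr0_norm// => /(_ hd).
have -> : - h *: 1 + t = t - h by rewrite /GRing.scale/= mulr1 addrC.
move=> Hh; have := Fz (P (t - h)).
suff : - \sum_i z i 0 * (P (t - h) i 0 - P t i 0) <= (c + e) * h by lra.
apply: (@le_trans _ _ (\sum_i (h * (z i 0 * ('D_1 P t) i 0) +
    `|z i 0| * (e / (\sum_i `|z i 0| + 1) * h)))).
  rewrite -sumrN; apply: ler_sum => i _.
  have := le_trans (coord_le_norm (P (t - h) - P t - - h *: 'D_1 P t) i) Hh.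
  rewrite !mxE => Hi.
  rewrite -lerBlDl; apply: le_trans (ler_norm _) _.
  apply: le_trans (ler_wpM2l (normr_ge0 (z i 0)) Hi); rewrite -normrM -normrN.
  by rewrite le_eqVlt; apply/orP; left; apply/eqP; congr `|_|; ring.
rewrite big_split/= -mulr_sumr -mulr_suml mulrDl lerD//.
  by rewrite mulrC ler_wpM2r// ltW.
rewrite mulrA ler_wpM2r ?(ltW h0)// mulrCA ler_piMr ?(ltW e0)//.
by rewrite ler_pdivrMr// mul1r lerDl.
Qed.

Lemma trajectory_barrier F P T c (kappa : R) (N : set R) : 0 < kappa ->
  bounded_lipschitz F -> (forall b, abs_continuous_on T b P) ->
  (@lebesgue_measure R).-negligible N ->
  (forall t, T < t -> ~ N t -> derivable P t 1 /\
    (c <= F (P t) -> exists2 z, subgradient F (P t) z &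
      \sum_i z i 0 * (derive1 P t) i 0 <= - kappa)) ->
  \forall t \near +oo, F (P t) <= c.
Proof.
move=> k0 lF acP N0 H; apply: (barrier (g := F \o P) k0 _ N0) => [b|t Tt Nt Ft].
  have [B HB] := abs_continuous_on_bounded (acP b).
  have [K K0 HK] := lF B.
  apply: (@abs_continuous_on_dominated _ _ _ P (F \o P) T b K 0) => //.
  move=> x y Tx xy yb.
  rewrite mul0r addr0 /=; apply: HK; apply: HB.
    by rewrite Tx (le_trans xy).
  by rewrite yb (le_trans Tx).
have [dP /(_ Ft)[z Fz zk]] := H t Tt Nt.
exact: subgradient_left_dini Fz zk.
Qed.

End Trajectory.

(** * Separable convex functions *)

Section Separable.
Context {R : realType} {n : nat} (g d : 'I_n -> R -> R).
Hypothesis gd : forall i x y, g i x + d i x * (y - x) <= g i y.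

Definition separable (x : 'cV[R]_n) := \sum_i g i (x i 0).

Lemma subderivative_le i x y : x <= y -> d i x <= d i y \/ x = y.
Proof.
move=> xy; have [->|nxy] := eqVneq x y; [by right|left].
have {nxy}xy : 0 < y - x by rewrite subr_gt0 lt_neqAle nxy.
by rewrite -(ler_pM2r xy); have := gd i x y; have := gd i y x; lra.
Qed.

(** By monotonicity the values at [B] and [- B] bound [d i] between them; the sum over [i] gives one
    bound for all coordinates. *)
Lemma subderivative_bounded B : exists2 K, 0 <= K &
  forall i x, `|x| <= B -> `|d i x| <= K.
Proof.
exists (\sum_i (`|d i B| + `|d i (- B)|)) => [|i x]; first exact: sumr_ge0.
rewrite ler_norml => /andP[Bx xB].
apply: (@le_trans _ _ (`|d i B| + `|d i (- B)|)); last first.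
  by rewrite (bigD1 i)//= lerDl; exact: sumr_ge0.
have : d i x <= `|d i B|.
  by have [/le_trans-> //|->] := subderivative_le i xB; rewrite ?ler_norm.
have : - `|d i (- B)| <= d i x.
  have [|<-] := subderivative_le i Bx; last by rewrite lerNl -normrN ler_norm.
  by apply: le_trans; rewrite lerNl -normrN ler_norm.
rewrite ler_norml; have := normr_ge0 (d i B); have := normr_ge0 (d i (- B)).
by move=> *; apply/andP; split; lra.
Qed.

Lemma separable_subgradient x : subgradient separable x (\col_i d i (x i 0)).
Proof.
move=> y; rewrite /separable -big_split/=; apply: ler_sum => i _.
by rewrite mxE.
Qed.

Lemma separable_bounded_lipschitz : bounded_lipschitz separable.
Proof.
move=> B; have [K K0 HK] := subderivative_bounded B.
have half x y : `|x| <= B -> `|y| <= B ->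
    separable x - separable y <= (\sum_(i < n) K) * `|y - x|.
  move=> xB yB; rewrite -sumrB mulr_suml; apply: ler_sum => i _.
  have := gd i (x i 0) (y i 0) => Hi.
  apply: (@le_trans _ _ (- (d i (x i 0) * (y i 0 - x i 0)))); first lra.
  apply: le_trans (ler_norm _) _; rewrite normrN normrM ler_pM//.
    by rewrite HK// (le_trans (coord_le_norm _ _)).
  by have := coord_le_norm (y - x) i; rewrite !mxE.
exists (\sum_(i < n) K) => [|x y xB yB]; first exact: sumr_ge0.
have := half x y xB yB; have := half y x yB xB.
by rewrite distrC ler_norml => *; apply/andP; split; lra.
Qed.

End Separable.

Lemma bounded_lipschitz_continuous {R : realType} {n : nat}
    (F : 'cV[R]_n -> R) : bounded_lipschitz F -> continuous F.
Proof.
move=> lF x; have [K K0 HK] := lF (`|x| + 1).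
apply/(@cvgrPdist_le _ _ _ (nbhs x)) => e e0.
have K1 : 0 < K + 1 by rewrite ltr_wpDl.
apply/nbhs_ballP; exists (Num.min 1 (e / (K + 1))) => /=.
  by rewrite lt_min ltr01 divr_gt0.
move=> y; rewrite mx_norm_ball /ball_/= lt_min => /andP[xy1 xy2].
rewrite distrC in xy1 xy2; rewrite distrC.
apply: (@le_trans _ _ (K * `|y - x|)).
  apply: HK; first by rewrite lerDl.
  by rewrite -[y](subrK x) addrC (le_trans (ler_normD _ _))// lerD2l ltW.
rewrite ltr_pdivlMr// in xy2; have := normr_ge0 (y - x); nra.
Qed.

(** * Dissipation by the Laplacian *)

Section Laplacian.
Context {R : realType} {n : nat} (A : 'M[R]_n).
Hypothesis A_balanced : weight_balanced A.
Implicit Type z : 'cV[R]_n.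

Lemma laplacian_mulE z i :
  (laplacian A *m z) i 0 = \sum_j A i j * (z i 0 - z j 0).
Proof.
rewrite /laplacian mulmxBl mul_diag_mx !mxE mulr_suml -sumrB.
by apply: eq_bigr => j _; ring.
Qed.

(** Exchanging the sums turns row sums into column sums. Used for the coordinates of [z], where it
    says that the Laplacian preserves the total, and for their squares. *)
Lemma weight_balanced_sum0 (w : 'I_n -> R) :
  \sum_i \sum_j A i j * (w i - w j) = 0.
Proof.
transitivity (\sum_i \sum_j A i j * w i - \sum_i \sum_j A i j * w j).
  rewrite -sumrB; apply: eq_bigr => i _; rewrite -sumrB.
  by apply: eq_bigr => j _; rewrite mulrBr.
rewrite [X in _ - X]exchange_big/= -sumrB big1// => i _.
by rewrite -!mulr_suml A_balanced subrr.
Qed.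

Definition disagreement z := 2^-1 * \sum_i \sum_j A i j * (z i 0 - z j 0) ^+ 2.

(** Half of [(z_i - z_j)^2 + (z_i^2 - z_j^2)] is [z_i * (z_i - z_j)], and the differences of squares
    cancel by balance. *)
Lemma laplacian_quadratic_form z :
  \sum_i z i 0 * (laplacian A *m z) i 0 = disagreement z.
Proof.
have := weight_balanced_sum0 (fun i => z i 0 ^+ 2).
rewrite /disagreement mulr_sumr => /(congr1 (fun s => 2^-1 * s)).
rewrite mulr0 mulr_sumr => H; apply/eqP; rewrite -subr_eq0; apply/eqP.
rewrite -[RHS]H -sumrB; apply: eq_bigr => i _.
rewrite laplacian_mulE !mulr_sumr -sumrB.
by apply: eq_bigr => j _; field.
Qed.

Hypothesis A_ge0 : forall i j, 0 <= A i j.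
Hypothesis A_connected : strongly_connected A.

Lemma disagreement_ge0 z : 0 <= disagreement z.
Proof.
rewrite mulr_ge0// sumr_ge0// => i _; rewrite sumr_ge0// => j _.
by rewrite mulr_ge0// sqr_ge0.
Qed.

(** Induction along a directed path, with [(u + v)^2 <= 2 * u^2 + 2 * v^2] at each edge; the squared
    difference across an edge is, up to a constant, one term of the disagreement. *)
Lemma disagreement_bound : exists2 C : R, 0 < C &
  forall z i j, (z i 0 - z j 0) ^+ 2 <= C * disagreement z.
Proof.
have pathC p i : path (edge A) i p -> exists2 C : R, 0 <= C &
    forall z, (z i 0 - z (last i p) 0) ^+ 2 <= C * disagreement z.
  elim: p i => [|k p IH] i /=.
    by exists 0 => // z; rewrite subrr expr0n/= mul0r.
  case/andP => Aik /IH[C C0 HC]; exists (4 / A i k + 2 * C).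
    by rewrite addr_ge0// ?mulr_ge0// invr_ge0.
  move=> z; have := HC z; set l := last k p => Hl.
  have Hik : (z i 0 - z k 0) ^+ 2 <= 2 / A i k * disagreement z.
    rewrite -mulrA (mulrC _ (disagreement z)) mulrA ler_pdivlMr//.
    rewrite mulrA divff ?pnatr_eq0// mul1r (bigD1 i)//= (bigD1 k)//= mulrC.
    rewrite -addrA lerDl addr_ge0// sumr_ge0// => j _.
      by rewrite mulr_ge0// sqr_ge0.
    by rewrite sumr_ge0// => j' _; rewrite mulr_ge0// sqr_ge0.
  have := sqr_ge0 ((z i 0 - z k 0) - (z k 0 - z l 0)).
  have -> : 4 / A i k = 2 * (2 / A i k) by rewrite mulrA -natrM.
  move: (2 / A i k) Hik Hl => a.
  by rewrite !expr2; lra.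
have pairC i j : exists C : R, 0 <= C /\
    forall z, (z i 0 - z j 0) ^+ 2 <= C * disagreement z.
  have /connectP[p /pathC[C C0 HC] ->] := A_connected i j.
  by exists C.
pose C i j := projT1 (cid (pairC i j)).
have C0 i j : 0 <= C i j by rewrite /C; case: cid => /= ? [].
have HC z i j : (z i 0 - z j 0) ^+ 2 <= C i j * disagreement z.
  by rewrite /C; case: cid => /= ? [].
exists (\sum_i \sum_j C i j + 1).
  by rewrite ltr_wpDl// sumr_ge0// => i _; rewrite sumr_ge0.
move=> z i j; apply: le_trans (HC z i j) _.
apply: ler_wpM2r; first exact: disagreement_ge0.
rewrite (bigD1 i)//= (bigD1 j)//= -!addrA lerDl !addr_ge0// ?sumr_ge0// => k _.
by rewrite sumr_ge0.
Qed.

End Laplacian.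

(** * Rate of descent *)

Section Descent.
Context {R : realType} {n : nat} (g d : 'I_n -> R -> R).
Hypothesis gd : forall i x y, g i x + d i x * (y - x) <= g i y.
Local Notation F := (separable g).

Lemma separable_subgradient_coord x z i y : subgradient F x z ->
  g i (x i 0) + z i 0 * (y - x i 0) <= g i y.
Proof.
pose x' : 'cV[R]_n := \col_j if j == i then y else x j 0.
move=> /(_ x'); rewrite /separable.
have -> : \sum_j z j 0 * (x' j 0 - x j 0) = z i 0 * (y - x i 0).
  rewrite (bigD1 i)//= big1 => [|j ji]; last first.
    by rewrite mxE (negbTE ji) subrr mulr0.
  by rewrite mxE eqxx addr0.
rewrite (bigD1 i)//= [leRHS](bigD1 i)//= {1}/x' mxE eqxx.
have -> : \sum_(j | j != i) g j (x' j 0) = \sum_(j | j != i) g j (x j 0).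
  by apply: eq_bigr => j ji; rewrite mxE (negbTE ji).
by lra.
Qed.

(* If the coordinates of [x] have a bounded sum then one of them is bounded
   above and one below, and monotonicity of the subderivatives applies. *)
Lemma subgradient_sign_bounds (s : R) : (0 < n)%N -> exists2 M, 0 <= M &
  forall x z, subgradient F x z -> `|s - \sum_i x i 0| <= 1 ->
    (exists k, z k 0 <= M) /\ (exists k, - M <= z k 0).
Proof.
move=> n0; pose X := `|s| + 1.
have X0 : 0 <= X by rewrite addr_ge0.
(* The margin 1 keeps [X + 1] strictly above a coordinate that is at most [X], so that slopes are
   compared across a positive gap. *)
have [M M0 HM] := subderivative_bounded gd (X + 1).
have n1 : 1 <= n%:R :> R by rewrite ler1n.
have XnX : X <= \sum_(i < n) X.
  by rewrite sumr_const card_ord -mulr_natr ler_peMr.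
exists M => // x z Fz; rewrite ler_norml => /andP[sx1 sx2].
have := ler_norm s; have := lerNnormlW (lexx `|s|) => sl sr; split.
- have [k xk] : exists k, x k 0 <= X.
    apply: contrapT => /forallNP xX.
    have : \sum_(i < n) X < \sum_i x i 0.
      apply: ltr_sum => [|i _].
        by apply/hasP; exists (Ordinal n0); rewrite ?mem_index_enum.
      by rewrite ltNge; exact/negP.
    by move: sr XnX; rewrite /X; lra.
  exists k; apply: (@le_trans _ _ (d k (X + 1))).
    have k1 : 0 < X + 1 - x k 0 by lra.
    rewrite -(ler_pM2r k1); have := separable_subgradient_coord k (X + 1) Fz.
    by have := gd k (X + 1) (x k 0); lra.
  by apply: le_trans (ler_norm _) _; rewrite HM// ger0_norm// addr_ge0.
- have [k xk] : exists k, - X <= x k 0.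
    apply: contrapT => /forallNP xX.
    have : \sum_i x i 0 < \sum_(i < n) - X.
      apply: ltr_sum => [|i _].
        by apply/hasP; exists (Ordinal n0); rewrite ?mem_index_enum.
      by rewrite ltNge; exact/negP.
    by rewrite sumrN; move: sl XnX; rewrite /X; lra.
  exists k; apply: (@le_trans _ _ (d k (- (X + 1)))).
    rewrite lerNl; apply: le_trans (ler_norm _) _.
    by rewrite normrN HM// normrN ger0_norm// addr_ge0.
  have k1 : 0 < x k 0 + X + 1 by lra.
  rewrite -(ler_pM2r k1); have := separable_subgradient_coord k (- (X + 1)) Fz.
  by have := gd k (- (X + 1)) (x k 0); lra.
Qed.

Variable A : 'M[R]_n.
Hypothesis A_balanced : weight_balanced A.
Hypothesis A_ge0 : forall i j, 0 <= A i j.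
Hypothesis A_connected : strongly_connected A.

(* The components of a subgradient differ by at most the square root [sg] of a
   multiple of the dissipation, so [F x - F xs <= <z, x - xs>] forces [sg] to
   be bounded below as soon as [F x - F xs] is. *)
Lemma descent_rate (xs : 'cV[R]_n) (a b eta : R) : (0 < n)%N ->
  0 <= a -> 0 <= b -> 0 < eta ->
  (forall x : 'cV[R]_n, \sum_i `|x i 0 - xs i 0| <= a * (F x - F xs) + b) ->
  exists kappa tau, [/\ 0 < kappa, 0 < tau &
    forall x z : 'cV[R]_n, subgradient F x z ->
    let r := \sum_i xs i 0 - \sum_i x i 0 in
    `|r| <= tau -> eta <= F x - F xs ->
    \sum_i z i 0 * (- (laplacian A *m z) + (n%:R^-1 * r) *: const_mx 1) i 0
      <= - kappa].
Proof.
move=> n0 a0 b0 eta0 coercive.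
have [M M0 HM] := subgradient_sign_bounds (\sum_i xs i 0) n0.
have [C C0 HC] := disagreement_bound A_ge0 A_connected.
pose D := a * eta + b + 1.
have D0 : 0 < D by rewrite ltr_wpDl// addr_ge0// mulr_ge0// ltW.
pose s0 := eta / (2 * D).
have s0_gt0 : 0 < s0 by rewrite divr_gt0// mulr_gt0.
have s0D : s0 * (2 * D) = eta by rewrite divfK// gt_eqF// mulr_gt0.
have M1 : 0 < M + 1 by rewrite ltr_wpDl.
(* In turn: the sign bounds apply; [M * tau] is at most half of [eta]; and, once [s0 <= sg], the
   errors [tau * sg] and [tau * M] each consume at most a quarter of the dissipation [sg ^+ 2 / C].
   The remaining half is at least [kappa]. *)
pose tau := Num.min 1 (Num.min (eta / (2 * (M + 1)))
  (Num.min (s0 / (4 * C)) (s0 ^+ 2 / (4 * C * (M + 1))))).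
have tau0 : 0 < tau.
  rewrite !lt_min ltr01 /= !divr_gt0 ?exprn_gt0//; do ?exact: mulr_gt0.
  by rewrite !mulr_gt0.
have [tau1 tau2 tau3 tau4] : [/\ tau <= 1, tau * (2 * (M + 1)) <= eta,
    tau * (4 * C) <= s0 & tau * (4 * C * (M + 1)) <= s0 ^+ 2].
  rewrite -!ler_pdivlMr ?mulr_gt0//.
  by split; rewrite !ge_min lexx ?orbT.
exists (s0 ^+ 2 / (2 * C)), tau; split=> //.
  by rewrite divr_gt0 ?exprn_gt0// mulr_gt0.
move=> x z Fz r rtau wle; set w := F x - F xs in wle.
have q0 := disagreement_ge0 A_ge0 z; set q := disagreement A z in q0.
pose sg := Num.sqrt (C * q).
have sg0 : 0 <= sg by exact: sqrtr_ge0.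
have sgE : sg ^+ 2 = C * q by rewrite sqr_sqrtr// mulr_ge0// ltW.
have spread i j : `|z i 0 - z j 0| <= sg by rewrite -sqrtr_sqr ler_wsqrtr// HC.
have [[k1 zk1] [k2 zk2]] := HM x z Fz (le_trans rtau tau1).
have zle i : `|z i 0| <= M + sg.
  rewrite ler_norml; have := spread i k1; have := spread i k2.
  by rewrite !ler_norml => /andP[? ?] /andP[? ?]; apply/andP; split; lra.
(* Subtracting the constant [z k1 0] from [z] splits the pairing: the differences are at most [sg]
   and meet the coercivity bound, the constant meets only the imbalance [r]. *)
have w_le : w <= sg * (a * w + b) + (M + sg) * tau.
  apply: (@le_trans _ _
    (\sum_i (z i 0 - z k1 0) * (x i 0 - xs i 0) - z k1 0 * r)).
    have := Fz xs; rewrite /w /r; set S := \sum_i _ * _ => HF.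
    suff -> : \sum_i (z i 0 - z k1 0) * (x i 0 - xs i 0) =
        - S - z k1 0 * (\sum_i x i 0 - \sum_i xs i 0) by lra.
    rewrite -sumrB mulr_sumr /S -sumrN -sumrB.
    by apply: eq_bigr => i _; ring.
  apply: lerD; last first.
    apply: le_trans (ler_norm _) _; rewrite normrN normrM ler_pM//.
  apply: le_trans (ler_wpM2l sg0 (coercive x)); rewrite mulr_sumr.
  apply: ler_sum => i _; apply: le_trans (ler_norm _) _.
  by rewrite normrM ler_wpM2r.
(* Otherwise [w * D < eta * (a * w + b + 1)], and since [D = a * eta + b + 1] this means
   [w < eta]. *)
have s0sg : s0 <= sg.
  rewrite leNgt; apply/negP => sgs0.
  have H1 : w / 2 <= sg * (a * w + b + 1) by nra.
  have aw : 0 < a * w + b + 1.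
    by rewrite ltr_wpDl// addr_ge0// mulr_ge0// (le_trans (ltW eta0)).
  have H2 : w / 2 < s0 * (a * w + b + 1).
    by apply: le_lt_trans H1 _; rewrite ltr_pM2r.
  have : w * D < s0 * (2 * D) * (a * w + b + 1).
    have := H2; rewrite -(ltr_pM2r D0); lra.
  by rewrite s0D /D; nra.
rewrite (eq_bigr (fun i => - (z i 0 * (laplacian A *m z) i 0) +
    n%:R^-1 * r * z i 0)); last by move=> i _; rewrite !mxE; ring.
rewrite big_split/= sumrN laplacian_quadratic_form// -/q -mulr_sumr.
have avg : n%:R^-1 * r * \sum_i z i 0 <= tau * (M + sg).
  apply: le_trans (ler_norm _) _; rewrite mulrAC mulrC normrM ler_pM//.
  rewrite normrM ger0_norm ?invr_ge0// mulrC ler_pdivrMr ?ltr0n//.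
  apply: le_trans (ler_norm_sum _ _ _) _.
  apply: le_trans (ler_sum _ (fun i _ => zle i)) _.
  by rewrite sumr_const card_ord mulr_natr.
have C2 : 0 < 2 * C by rewrite mulr_gt0.
rewrite lerNr ler_pdivrMr//.
have : 2 * C * (tau * M) <= s0 ^+ 2 / 2 by nra.
have : 2 * C * (tau * sg) <= sg ^+ 2 / 2 by nra.
have : s0 ^+ 2 <= sg ^+ 2 by rewrite ler_sqr// nnegrE ltW.
by nra.
Qed.

End Descent.

(** * Compactness and convexity *)

Section Compactness.
Context {R : realType} {n : nat}.

Lemma trmx_continuous m : continuous (@trmx R m n).
Proof.
move=> x; apply/(@cvg_ballP _ _ _ (nbhs x)) => e e0.
apply/nbhs_ballP; exists e => // y [_ xy]; split=> // i j.
by rewrite !mxE; exact: xy.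
Qed.

Lemma cV_closed_bounded_compact (A : set 'cV[R]_n) (B : R) :
  closed A -> (forall x, A x -> `|x| <= B) -> compact A.
Proof.
move=> cA bA; have -> : A = trmx @` (trmx @^-1` A : set 'rV[R]_n).
  apply/seteqP; split=> [x Ax|_ [x Ax <-] //].
  by exists x^T; rewrite /= trmxK.
apply: continuous_compact.
  by apply: continuous_subspaceT => x; exact: trmx_continuous.
apply: bounded_closed_compact; last first.
  by apply: closed_comp => // x _; exact: trmx_continuous.
exists B; split=> [|r Br v /= /bA vB]; first exact: num_real.
apply: (le_trans _ (ltW Br)); apply: (le_trans _ vB).
rewrite [leLHS]/Num.Def.normr/= mx_normrE; apply/bigmax_leP.
split=> // -[i j] _ /=; rewrite ord1.
by apply: le_trans (coord_le_norm v^T j); rewrite mxE.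
Qed.
End Compactness.

(** The chord bounds [f] at [t * y + (1 - t) * x] from above, the expansion at [x] from below;
    dividing by a small [t] leaves the tangent inequality up to [e]. *)
Lemma convex_derive_le {R : realType} (f : R -> R) x y :
  convex_function [set: R] f -> derivable f x 1 ->
  f x + derive1 f x * (y - x) <= f y.
Proof.
move=> cf df; rewrite derive1E; have [->|yx] := eqVneq y x.
  by rewrite subrr mulr0 addr0.
have yx0 : 0 < `|y - x| by rewrite normr_gt0 subr_eq0.
apply/ler_addgt0Pr => e e0.
have [d d0 Hd] := derivable_littleo df (divr_gt0 e0 yx0).
pose t := Num.min 1 (d / 2 / `|y - x|).
have t0 : 0 < t by rewrite lt_min ltr01 !divr_gt0.
have t1 : t <= 1 by rewrite ge_min lexx.
have td : t * `|y - x| < d.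
  apply: (@le_lt_trans _ _ (d / 2)); last lra.
  by rewrite -ler_pdivlMr// ge_min lexx orbT.
have := Hd (t * (y - x)); rewrite normrM gtr0_norm// => /(_ td).
have t01 : (0 <= t <= 1)%R by rewrite ltW.
have -> : (t * (y - x)) *: (1 : R) + x = t * y + (1 - t) * x.
  by rewrite /GRing.scale/=; ring.
have : f (t * y + (1 - t) * x) <= t * f y + (1 - t) * f x.
  pose t' : {i01 R} := Itv01 (ltW t0) t1.
  by have := cf t' y x; rewrite !inE => /(_ I I).
rewrite ler_norml => H1 /andP[H2 _]; rewrite /GRing.scale/= in H2.
have -> : e = e / `|y - x| * `|y - x| by rewrite divfK// gt_eqF.
move: H1 H2; move: (e / _) ('D_1 f x) => c D H1 H2.
by rewrite -(ler_pM2l t0); lra.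
Qed.

(** * Adjusting a coordinate sum inside a box *)

Section BoxShift.
Context {R : realType} {n : nat}.
Implicit Types lo hi q c : 'I_n -> R.

(** Only the coordinates where [c] exceeds [q] move, each by the same fraction of its excess. All
    moves go down, so their total length is exactly the change of the sum. *)
Lemma box_shift_le lo hi q c : (forall i, lo i <= q i <= hi i) ->
  (forall i, lo i <= c i <= hi i) -> \sum_i q i <= \sum_i c i ->
  exists y : 'I_n -> R, [/\ forall i, lo i <= y i <= hi i,
    \sum_i y i = \sum_i q i & \sum_i `|c i - y i| = \sum_i c i - \sum_i q i].
Proof.
move=> loq loc qc.
pose m i := Num.max 0 (c i - q i); pose r := \sum_i c i - \sum_i q i.
have m0 i : 0 <= m i by rewrite le_max lexx.
have rm : r <= \sum_i m i.
  by rewrite /r -sumrB; apply: ler_sum => i _; rewrite le_max lexx orbT.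
have r0 : 0 <= r by rewrite subr_ge0.
have M0 : 0 <= \sum_i m i by exact: sumr_ge0.
(* If no coordinate has an excess, then [r = 0] and the quotient by 0 is 0, as required. *)
pose th := r / \sum_i m i.
have th0 : 0 <= th by rewrite divr_ge0.
have thm : th * \sum_i m i = r.
  have [Me|Mn] := eqVneq (\sum_i m i) 0; last by rewrite divfK.
  by rewrite Me mulr0; apply/eqP; rewrite eq_le r0 -[X in _ <= X]Me rm.
have th1 : th <= 1.
  have [Me|Mn] := eqVneq (\sum_i m i) 0; first by rewrite /th Me invr0 mulr0.
  by rewrite ler_pdivrMr ?mul1r// lt_neqAle eq_sym Mn.
exists (fun i => c i - th * m i); split=> [i||].
- have /andP[? ?] := loq i; have /andP[? ?] := loc i; have := m0 i.
  by rewrite /m; case: (leP 0 (c i - q i)) => ? ?; apply/andP; split; nra.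
- by rewrite sumrB -mulr_sumr thm /r; ring.
- rewrite -/r -thm mulr_sumr; apply: eq_bigr => i _.
  by rewrite subKr ger0_norm// mulr_ge0.
Qed.

Lemma box_shift lo hi q c : (forall i, lo i <= q i <= hi i) ->
  (forall i, lo i <= c i <= hi i) ->
  exists y : 'I_n -> R, [/\ forall i, lo i <= y i <= hi i,
    \sum_i y i = \sum_i q i & \sum_i `|c i - y i| = `|\sum_i c i - \sum_i q i|].
Proof.
move=> loq loc; have [qc|/ltW cq] := leP (\sum_i q i) (\sum_i c i).
  by have [y [? ? Hy]] := box_shift_le loq loc qc; exists y; split=> //;
    rewrite Hy ger0_norm// subr_ge0.
have [||| y [loy sy dy]] :=
    @box_shift_le (fun i => - hi i) (fun i => - lo i)
      (fun i => - q i) (fun i => - c i).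
- by move=> i; rewrite !lerN2 andbC.
- by move=> i; rewrite !lerN2 andbC.
- by rewrite !sumrN lerN2.
exists (fun i => - y i); split.
- by move=> i; have /andP[? ?] := loy i; rewrite lerNr lerNl; apply/andP.
- by rewrite sumrN sy sumrN opprK.
- rewrite ler0_norm ?subr_le0// opprB.
  transitivity (\sum_i `|- c i - y i|).
    by apply: eq_bigr => i _; rewrite -normrN; congr `|_|; ring.
  by rewrite dy !sumrN; ring.
Qed.

End BoxShift.

(** * Exact penalty *)

Section Dispatch.
Context {R : realType} {n : nat}.
Variables (f : 'I_n -> R -> R) (Pl : R) (Pm PM : 'cV[R]_n) (eps : R).
Hypothesis f_ge0 : forall i x, 0 <= f i x.
Hypothesis f_convex : forall i, convex_function [set: R] (f i).
Hypothesis f_derivable : forall i x, derivable (f i) x 1.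
Hypothesis eps_gt0 : 0 < eps.
Implicit Types x y : 'cV[R]_n.

Local Notation cost := (total_cost f).
Local Notation F := (penalized_cost f Pm PM eps).
Local Notation Feas := (feasible Pm PM Pl).
Local Notation Gmax := (max_gradient_norm f Pm PM Pl).
Local Notation Opt := (ED_solutions f Pm PM Pl).

Definition box_penalty i (p : R) :=
  Num.max 0 (p - PM i 0) + Num.max 0 (Pm i 0 - p).

(** One choice of subderivative of [box_penalty]: each of the two terms gets slope 0 at its kink. *)
Definition box_penalty_slope i (p : R) : R :=
  (PM i 0 < p)%R%:R - (p < Pm i 0)%R%:R.

Definition violation x := \sum_i box_penalty i (x i 0).

Lemma box_penalty_ge0 i p : 0 <= box_penalty i p.
Proof. by rewrite addr_ge0// le_max lexx. Qed.

Lemma box_penalty_eq0 i p : (box_penalty i p == 0) = (Pm i 0 <= p <= PM i 0).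
Proof.
rewrite /box_penalty paddr_eq0 ?le_max ?lexx//.
have maxE (a : R) : (Num.max 0 a == 0) = (a <= 0).
  by case: (leP a 0) => [_|a0]; [exact: eqxx|exact: gt_eqF].
by rewrite !maxE !subr_le0 andbC.
Qed.

Lemma box_penalty_subderivative i p q :
  box_penalty i p + box_penalty_slope i p * (q - p) <= box_penalty i q.
Proof.
rewrite /box_penalty /box_penalty_slope.
case: (ltP (PM i 0) p) => ?; case: (ltP p (Pm i 0)) => ?;
case: (leP 0 (p - PM i 0)) => ?; case: (leP 0 (Pm i 0 - p)) => ?;
case: (leP 0 (q - PM i 0)) => ?; case: (leP 0 (Pm i 0 - q)) => ? /=; lra.
Qed.

Lemma violation_ge0 x : 0 <= violation x.
Proof. by apply: sumr_ge0 => i _; exact: box_penalty_ge0. Qed.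

Lemma violation_eq0 x :
  violation x = 0 -> forall i, Pm i 0 <= x i 0 <= PM i 0.
Proof.
move=> /eqP; rewrite psumr_eq0 => [/allP x0 i|i _]; last exact: box_penalty_ge0.
by rewrite -box_penalty_eq0; apply: x0; rewrite mem_index_enum.
Qed.

Lemma feasible_violation x : Feas x -> violation x = 0.
Proof.
by move=> [xbox _]; apply: big1 => i _; apply/eqP; rewrite box_penalty_eq0.
Qed.

Lemma penalized_costE x : F x = cost x + eps^-1 * violation x.
Proof. by []. Qed.

Lemma penalized_cost_feasible x : Feas x -> F x = cost x.
Proof.
by move=> /feasible_violation x0; rewrite penalized_costE x0 mulr0 addr0.
Qed.

Lemma penalized_cost_separable :
  F = separable (fun i p => f i p + eps^-1 * box_penalty i p).
Proof. by apply/funext => x; rewrite /separable big_split/= -mulr_sumr. Qed.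

Lemma cost_subderivative i p q :
  f i p + derive1 (f i) p * (q - p) <= f i q.
Proof. exact: convex_derive_le. Qed.

Lemma penalized_subderivative i p q :
  f i p + eps^-1 * box_penalty i p +
    (derive1 (f i) p + eps^-1 * box_penalty_slope i p) * (q - p) <=
  f i q + eps^-1 * box_penalty i q.
Proof.
have := cost_subderivative i p q.
have e0 : 0 <= eps^-1 by rewrite invr_ge0 ltW.
by have := ler_wpM2l e0 (box_penalty_subderivative i p q); lra.
Qed.

Lemma gradient_total_cost x i : gradient cost x i 0 = derive1 (f i) (x i 0).
Proof.
rewrite mxE /derive /derive1.
set u := fun h : R => _; set v := fun h : R => h^-1 *: (f i _ - _).
suff -> : u = v by [].
apply/funext => h; rewrite /u /v/=; congr (_ *: _).
rewrite /total_cost -sumrB (bigD1 i)//= big1 => [|j ji].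
  by rewrite !mxE !eqxx mulr1 addr0.
by rewrite !mxE (negbTE ji) mulr0 add0r subrr.
Qed.

(** Ensures that the [sup] defining [Gmax] really bounds the gradients on the feasible set. *)
Lemma gradient_norm_bounded : has_ubound [set `|gradient cost x| | x in Feas].
Proof.
pose B := \sum_i (`|Pm i 0| + `|PM i 0|).
have [K K0 HK] := subderivative_bounded cost_subderivative B.
exists K => _ [y [ybox _] <-]; apply: normcV_le => // j.
rewrite gradient_total_cost; apply: (HK j (y j 0)).
apply: (@le_trans _ _ (`|Pm j 0| + `|PM j 0|)).
  have /andP[? ?] := ybox j; have := ler_norm (PM j 0).
  have := lerNnormlW (lexx `|Pm j 0|).
  have := normr_ge0 (Pm j 0); have := normr_ge0 (PM j 0).
  by rewrite (ler_norml (y j 0)) => *; apply/andP; split; lra.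
by rewrite /B (bigD1 j)//= lerDl; apply: sumr_ge0.
Qed.

Lemma derive1_le_max_gradient_norm x i :
  Feas x -> `|derive1 (f i) (x i 0)| <= Gmax.
Proof.
move=> Fx; rewrite -gradient_total_cost.
apply: le_trans (coord_le_norm (gradient cost x) i) _.
by apply: (ub_le_sup gradient_norm_bounded); exists x.
Qed.

Hypothesis Feas_neq0 : Feas !=set0.

(* Clamp [x] to the box, then restore the coordinate sum inside the box: each
   of the two moves has length at most the violation, whence the factor 2. *)
Lemma feasible_near x : \sum_i x i 0 = Pl ->
  exists2 y, Feas y & \sum_i `|x i 0 - y i 0| <= 2 * violation x.
Proof.
move=> xPl; have [q [qbox qPl]] := Feas_neq0.
have lohi i : Pm i 0 <= PM i 0 by have /andP[/le_trans] := qbox i; apply.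
pose c i := Num.max (Pm i 0) (Num.min (PM i 0) (x i 0)).
have cbox i : Pm i 0 <= c i <= PM i 0.
  by rewrite /c le_max lexx/= ge_max lohi ge_min lexx.
have xc i : `|x i 0 - c i| <= box_penalty i (x i 0).
  have := lohi i; rewrite /c /box_penalty => ?; rewrite ler_norml.
  case: (leP (PM i 0) (x i 0)) => ?; case: (leP (Pm i 0)) => ?;
  case: (leP 0 (x i 0 - PM i 0)) => ?; case: (leP 0 (Pm i 0 - x i 0)) => ?;
  by apply/andP; split; lra.
have [y [ybox ysum dy]] := box_shift (c := c) qbox cbox.
have yE i : (\col_i y i : 'cV[R]_n) i 0 = y i by rewrite mxE.
exists (\col_i y i).
  split=> [i|]; first by rewrite yE.
  by rewrite -qPl -ysum; apply: eq_bigr => i _.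
have D1 : \sum_i `|x i 0 - c i| <= violation x by apply: ler_sum.
have D2 : \sum_i `|c i - y i| <= violation x.
  rewrite dy qPl -xPl -sumrB; apply: le_trans (ler_norm_sum _ _ _) _.
  by apply: le_trans D1; apply: ler_sum => i _; rewrite distrC.
apply: (@le_trans _ _ (\sum_i (`|x i 0 - c i| + `|c i - y i|))).
  by apply: ler_sum => i _; rewrite yE; exact: ler_distD.
by rewrite big_split/=; lra.
Qed.

Hypothesis eps_small : (eps%:E < ((2 * Gmax)%:E)^-1)%E.

Lemma max_gradient_norm_lt : 2 * Gmax < eps^-1.
Proof.
have G0 : 0 <= Gmax.
  have [q Fq] := Feas_neq0; apply: (le_trans (normr_ge0 (gradient cost q))).
  by apply: (ub_le_sup gradient_norm_bounded); exists q.
(* If [Gmax] vanishes, the extended inverse is infinite and the claim is just positivity of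
   [eps^-1]. *)
move: eps_small; rewrite inver; case: eqVneq => [->|G1].
  by rewrite invr_gt0.
have {G1}G0 : 0 < 2 * Gmax by rewrite lt_neqAle eq_sym G1 mulr_ge0.
by rewrite lte_fin -[X in X < _ -> _]invrK ltf_pV2 // posrE invr_gt0.
Qed.

(** The tangent inequality is taken at the feasible point [y], where [Gmax] bounds the slopes.
    Moving from [x] to [y] thus raises the cost by at most [2 * Gmax * violation x], less than the
    penalty saved when [x] violates the box. *)
Lemma exact_penalty x : \sum_i x i 0 = Pl -> exists2 y, Feas y &
  cost y + (eps^-1 - 2 * Gmax) * violation x <= F x.
Proof.
move=> xPl; have [y Fy yx] := feasible_near xPl; exists y => //.
have G0 : 0 <= Gmax.
  apply: (le_trans (normr_ge0 (gradient cost y))).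
  by apply: (ub_le_sup gradient_norm_bounded); exists y.
have : cost y - cost x <= Gmax * \sum_i `|x i 0 - y i 0|.
  rewrite /total_cost -sumrB mulr_sumr; apply: ler_sum => i _.
  have H := cost_subderivative i (y i 0) (x i 0).
  apply: (@le_trans _ _ (- (derive1 (f i) (y i 0) * (x i 0 - y i 0)))).
    lra.
  apply: le_trans (ler_norm _) _; rewrite normrN normrM ler_wpM2r//.
  exact: derive1_le_max_gradient_norm.
have := ler_wpM2l G0 yx; rewrite penalized_costE; lra.
Qed.

Lemma penalized_optimal x xs : Opt xs -> \sum_i x i 0 = Pl -> F x <= F xs ->
  Opt x.
Proof.
move=> [Fxs xs_min] xPl; rewrite (penalized_cost_feasible Fxs) => xxs.
have [y Fy yx] := exact_penalty xPl.
have x0 : violation x = 0.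
  apply/eqP; rewrite eq_le violation_ge0 andbT.
  have e0 : 0 < eps^-1 - 2 * Gmax by rewrite subr_gt0 max_gradient_norm_lt.
  by rewrite -(ler_pM2l e0) mulr0; have := xs_min y Fy; lra.
split=> [|z Fz]; first by split=> //; exact: violation_eq0.
apply: le_trans (xs_min z Fz); apply: le_trans xxs.
by rewrite penalized_costE x0 mulr0 addr0.
Qed.

Lemma penalized_bounded_lipschitz : bounded_lipschitz F.
Proof.
rewrite penalized_cost_separable.
exact: (separable_bounded_lipschitz penalized_subderivative).
Qed.

Lemma penalized_continuous : continuous F.
Proof. exact: bounded_lipschitz_continuous penalized_bounded_lipschitz. Qed.

(** Each coordinate deviates by at most its penalty plus the width of the box, and nonnegativity of
    [f] bounds the violation by [eps * F x]. This supplies both compact sublevel sets and the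
    coercivity needed in [descent_rate]. *)
Lemma dist_feasible_le y x : Feas y ->
  \sum_i `|x i 0 - y i 0| <= eps * F x + \sum_i (PM i 0 - Pm i 0).
Proof.
move=> [ybox _].
apply: (@le_trans _ _ (violation x + \sum_i (PM i 0 - Pm i 0))).
  rewrite -big_split/=; apply: ler_sum => i _; have /andP[? ?] := ybox i.
  rewrite /box_penalty ler_norml.
  case: (leP 0 (x i 0 - PM i 0)) => ?; case: (leP 0 (Pm i 0 - x i 0)) => ?;
  by apply/andP; split; lra.
rewrite lerD2r penalized_costE mulrDr mulrA divff ?gt_eqF// mul1r lerDr.
by rewrite mulr_ge0 ?(ltW eps_gt0)// sumr_ge0.
Qed.

Lemma norm_le_dist (x y : 'cV[R]_n) : `|x| <= `|y| + \sum_i `|x i 0 - y i 0|.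
Proof.
apply: normcV_le => [|i]; first by rewrite addr_ge0// sumr_ge0.
rewrite -[x i 0](subrK (y i 0)) addrC (le_trans (ler_normD _ _))// lerD//.
  exact: coord_le_norm.
by rewrite (bigD1 i)//= lerDl; apply: sumr_ge0.
Qed.

Lemma penalized_sublevel_compact (c : R) (A : set 'cV[R]_n) :
  closed A -> A `<=` [set x | F x <= c] -> compact A.
Proof.
move=> cA Ac; have [q Fq] := Feas_neq0.
apply: (@cV_closed_bounded_compact _ _ _
  (`|q| + (eps * c + \sum_i (PM i 0 - Pm i 0)))) => // x /Ac /= xc.
apply: le_trans (norm_le_dist x q) _; rewrite lerD2l.
apply: le_trans (dist_feasible_le x Fq) _.
by rewrite lerD2r ler_wpM2l// ltW.
Qed.

Lemma closed_sublevel (G : 'cV[R]_n -> R) (c : R) :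
  continuous G -> closed [set x | G x <= c].
Proof.
move=> cG; apply: (@closed_comp _ _ G [set r | r <= c]) => [x _|].
  exact: cG.
exact: closed_le.
Qed.

Lemma imbalance_bounded_lipschitz :
  bounded_lipschitz (fun x : 'cV[R]_n => `|Pl - \sum_i x i 0|).
Proof.
move=> B; exists n%:R => // x y _ _; apply: le_trans (ler_dist_dist _ _) _.
have -> : Pl - \sum_i y i 0 - (Pl - \sum_i x i 0) =
    - \sum_i (y i 0 - x i 0) by rewrite sumrB; ring.
rewrite normrN; apply: le_trans (ler_norm_sum _ _ _) _.
apply: (@le_trans _ _ (\sum_(i < n) `|y - x|)).
  by apply: ler_sum => i _; have := coord_le_norm (y - x) i; rewrite !mxE.
by rewrite sumr_const card_ord mulr_natl.
Qed.

Lemma ED_solutions_neq0 : Opt !=set0.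
Proof.
have [q Fq] := Feas_neq0.
pose G x := violation x + `|Pl - \sum_i x i 0|.
have cV : continuous violation.
  apply: bounded_lipschitz_continuous.
  exact: (separable_bounded_lipschitz box_penalty_subderivative).
have cG : continuous G.
  move=> x; apply: (cvgD (cV x)).
  exact: (bounded_lipschitz_continuous imbalance_bounded_lipschitz).
have FeasE : Feas = [set x | G x <= 0].
  apply/seteqP; split=> x.
    move=> Fx; rewrite /= /G (feasible_violation Fx) add0r.
    by have [_ ->] := Fx; rewrite subrr normr0.
  rewrite /= /G => Gx; have := violation_ge0 x.
  have := normr_ge0 (Pl - \sum_i x i 0) => N0 V0.
  split; first by apply: violation_eq0; lra.
  have /eqP : `|Pl - \sum_i x i 0| = 0 by lra.
  by rewrite normr_eq0 subr_eq0 => /eqP.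
have cF : compact Feas.
  apply: (@cV_closed_bounded_compact _ _ _
      (`|q| + \sum_i (PM i 0 - Pm i 0))).
    by rewrite FeasE; exact: closed_sublevel.
  move=> x [xbox _]; apply: le_trans (norm_le_dist x q) _; rewrite lerD2l.
  apply: ler_sum => i _; have /andP[? ?] := xbox i.
  have /andP[? ?] := Fq.1 i.
  by rewrite ler_norml; apply/andP; split; lra.
have [||c + Hc] := compact_EVT_min _ cF (f := cost) _; first by exists q.
  apply: continuous_subspaceT; apply: bounded_lipschitz_continuous.
  exact: (separable_bounded_lipschitz cost_subderivative).
by rewrite inE => Fc; exists c; split=> // y Fy; apply: Hc; rewrite inE.
Qed.

(** On the compact set [K] of points of a sublevel set at distance at least [e] from every solution,
    [G] attains its minimum. Exactness of the penalty makes it positive, and half of it serves as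
    [eta]. *)
Lemma near_ED_solutions xs (e : R) : Opt xs -> 0 < e ->
  exists2 eta, 0 < eta & forall x, F x - F xs <= eta ->
    `|Pl - \sum_i x i 0| <= eta -> exists2 y, Opt y & `|x - y| < e.
Proof.
move=> xs_opt e0; pose G x := Num.max (F x - F xs) `|Pl - \sum_i x i 0|.
pose K := [set x | F x <= F xs + 1] `&`
  \bigcap_(y in Opt) [set x | - `|x - y| <= - e].
have cK : compact K.
  apply: (@penalized_sublevel_compact (F xs + 1)) => [|x []//].
  apply: closedI; first exact: closed_sublevel penalized_continuous.
  apply: closed_bigI => y _; apply: closed_sublevel.
  apply: bounded_lipschitz_continuous => B; exists 1 => // x x' _ _.
  rewrite mul1r opprK addrC; apply: le_trans (ler_dist_dist _ _) _.
  by rewrite opprB addrA subrK distrC.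
have cG : continuous G.
  apply: (@max_fun_continuous _ _ _ (fun x => F x - F xs)
    (fun x => `|Pl - \sum_i x i 0|)).
    by move=> x; apply: (cvgB (@penalized_continuous x)); exact: cvg_cst.
  exact: bounded_lipschitz_continuous imbalance_bounded_lipschitz.
have near x : F x - F xs <= 1 -> ~ K x -> exists2 y, Opt y & `|x - y| < e.
  move=> x1 Kx; apply: contrapT => /forall2NP xO; apply: Kx; split=> /=.
    by lra.
  by move=> y Oy /=; have [//|/negP] := xO y; rewrite -leNgt lerN2.
have [K0|/set0P K0] := eqVneq K set0.
  by exists 1 => // x x1 _; apply: near => //; rewrite K0.
have [|c + Hc] := compact_EVT_min K0 cK (f := G) _.
  exact: continuous_subspaceT.
rewrite inE => -[c1 cO].
have Gc : 0 < G c.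
  rewrite ltNge; apply/negP; rewrite ge_max normr_le0 subr_eq0 subr_le0.
  move=> /andP[cxs /eqP cPl].
  have Oc : Opt c by exact: penalized_optimal xs_opt _ cxs.
  by have := cO _ Oc; rewrite /= subrr normr0 lerN2 leNgt e0.
exists (Num.min 1 (G c / 2)); first by rewrite lt_min ltr01 divr_gt0.
move=> x; rewrite !le_min => /andP[x1 x2] /andP[_ x3]; apply: near => // Kx.
have : G x <= G c / 2 by rewrite ge_max x2.
by have := Hc x; rewrite inE => /(_ Kx); lra.
Qed.

End Dispatch.

(** * Convergence of the trajectories *)

Lemma dispatch_direction_sum {R : realType} {n : nat} (A : 'M[R]_n)
    (z : 'cV[R]_n) (r : R) : weight_balanced A -> (0 < n)%N ->
  \sum_i (- (laplacian A *m z) + (n%:R^-1 * r) *: const_mx 1) i 0 = r.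
Proof.
move=> wA n0; transitivity
  (\sum_i (- \sum_j A i j * (z i 0 - z j 0) + n%:R^-1 * r)).
  by apply: eq_bigr => i _; rewrite -laplacian_mulE !mxE mulr1.
rewrite big_split/= sumrN (weight_balanced_sum0 wA (fun i => z i 0)).
rewrite oppr0 add0r sumr_const card_ord -[LHS]mulr_natl mulrA divff ?mul1r//.
by rewrite pnatr_eq0 -lt0n.
Qed.

Lemma imbalance_subgradient {R : realType} {n : nat} (s : R) (x : 'cV[R]_n) :
  subgradient (fun x => `|s - \sum_i x i 0|) x
    (const_mx (- Num.sg (s - \sum_i x i 0))).
Proof.
move=> y; set r := s - \sum_i x i 0.
under eq_bigr do rewrite mxE.
rewrite -mulr_sumr sumrB.
have -> : `|r| = Num.sg r * r by rewrite normrEsg.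
have -> : Num.sg r * r + - Num.sg r * (\sum_i y i 0 - \sum_i x i 0) =
    Num.sg r * (s - \sum_i y i 0) by rewrite /r; ring.
apply: le_trans (ler_norm _) _; rewrite normrM normr_sg.
by rewrite ler_piMl// lern1 leq_b1.
Qed.

(* In the bound on eps the quotient is taken in the extended reals, where
   0^-1 = +oo: no upper bound on eps if the gradient vanishes on the feasible
   set. *)
Theorem theorem4p1 (R : realType) (n : nat)
  (A : 'M[R]_n) (f : 'I_n -> R -> R) (Pl : R) (Pm PM : 'cV[R]_n) (eps : R)
  (A_ge0 : forall i j, 0 <= A i j)
  (A_strongly_connected : strongly_connected A)
  (A_weight_balanced : weight_balanced A)
  (f_ge0 : forall i x, 0 <= f i x)
  (f_convex : forall i, convex_function [set: R] (f i))
  (f_derivable : forall i x, derivable (f i) x 1)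
  (f_C1 : forall i, continuous (derive1 (f i)))
  (Pl_gt0 : 0 < Pl)
  (feasible_nonempty : feasible Pm PM Pl !=set0)
  (Pm_infeasible : ~ feasible Pm PM Pl Pm)
  (PM_infeasible : ~ feasible Pm PM Pl PM)
  (eps_gt0 : 0 < eps)
  (eps_small : (eps%:E < ((2 * max_gradient_norm f Pm PM Pl)%:E)^-1)%E)
  (P : R -> 'cV[R]_n)
  (P_trajectory : is_trajectory (dispatch_field A f Pm PM Pl eps) P) :
  edist_inf (ED_solutions f Pm PM Pl) (P t) @[t --> +oo] --> 0%E.
Proof.
have [xs xs_opt] := ED_solutions_neq0 f_convex f_derivable feasible_nonempty.
have Fxs : feasible Pm PM Pl xs by case: xs_opt.
(* In dimension 0 the empty sum could not equal the positive load. *)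
have n0 : (0 < n)%N.
  rewrite lt0n; apply/eqP => n0; move: Pl_gt0; case: Fxs => _ <-.
  rewrite big1 ?ltxx// => i _; exfalso.
  by have := ltn_ord i; rewrite [X in (_ < X)%N]n0.
have [acP aeP] := P_trajectory.
pose N := ~` [set t | 0 <= t -> derivable P t 1 /\
  dispatch_field A f Pm PM Pl eps (P t) (derive1 P t)].
have N0 : (@lebesgue_measure R).-negligible N := aeP.
set F := penalized_cost f Pm PM eps.
have gd := penalized_subderivative Pm PM f_convex f_derivable eps_gt0.
have lF : bounded_lipschitz F by exact: penalized_bounded_lipschitz.
have clarke x : generalized_gradient F x `<=` subgradient F x.
  apply: generalized_gradient_subgradient.
    exact: bounded_lipschitz_continuous.
  move=> y; rewrite /F penalized_cost_separable.
  exact: (ex_intro _ _ (separable_subgradient gd y)).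
have dynP t : 0 <= t -> ~ N t -> derivable P t 1 /\
    exists2 z, subgradient F (P t) z & derive1 P t =
      - (laplacian A *m z) +
      (n%:R^-1 * (Pl - \sum_i P t i 0)) *: const_mx 1.
  move=> t0 /contrapT/(_ t0)[dP [z /clarke Fz <-]].
  by split=> //; exists z.
have balance tau : 0 < tau ->
    \forall t \near +oo, `|Pl - \sum_i P t i 0| <= tau.
  move=> tau0; pose G (x : 'cV[R]_n) := `|Pl - \sum_i x i 0|.
  (* The imbalance decreases at a rate equal to itself, hence at least [tau] as long as it is at
     least [tau]. *)
  apply: (@trajectory_barrier _ _ G P 0 tau tau N) => //.
  - exact: imbalance_bounded_lipschitz.
  - by move=> b; exact: acP.
  move=> t t0 Nt; have [dP [z Fz dPE]] := dynP t (ltW t0) Nt.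
  split=> // Gt; pose r := Pl - \sum_i P t i 0.
  exists (const_mx (- Num.sg r)); first exact: imbalance_subgradient.
  under eq_bigr do rewrite mxE.
  rewrite -mulr_sumr dPE dispatch_direction_sum// mulNr lerN2.
  by rewrite -normrEsg.
have descent eta : 0 < eta -> \forall t \near +oo, F (P t) <= F xs + eta.
  move=> eta0; pose W := \sum_i (PM i 0 - Pm i 0).
  have W0 : 0 <= W.
    apply: sumr_ge0 => i _; rewrite subr_ge0.
    by have /andP[/le_trans] := Fxs.1 i; apply.
  have Fxs0 : 0 <= F xs.
    rewrite /F (penalized_cost_feasible f eps Fxs); exact: sumr_ge0.
  have FE := penalized_cost_separable f Pm PM eps.
  (* These [a] and [b] rewrite the bound [eps * F x + W] of [dist_feasible_le] in terms of
     [F x - F xs]. *)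
  have [||kappa [tau [kappa0 tau0 rate]]] := descent_rate (A := A) gd
      A_weight_balanced A_ge0 A_strongly_connected (xs := xs) (a := eps)
      (b := eps * F xs + W) n0 (ltW eps_gt0) _ eta0.
  - by apply: addr_ge0 => //; apply: mulr_ge0 => //; exact: ltW.
  - move=> x; rewrite -FE mulrBr addrA subrK.
    exact: (dist_feasible_le f_ge0 eps_gt0 x Fxs).
  have [T [Treal HT]] := balance tau tau0.
  (* The barrier starts only after time [T], when the imbalance is small enough for the descent rate
     to hold. *)
  apply: (@trajectory_barrier _ _ F P (Num.max 0 T) _ kappa N) => //.
    by move=> b; apply: acP; rewrite le_max lexx.
  move=> t; rewrite gt_max => /andP[t0 Tt] Nt.
  have [dP [z Fz dPE]] := dynP t (ltW t0) Nt.
  split=> // Ft; exists z => //; rewrite dPE.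
  have [_ <-] := Fxs; apply: rate; first by rewrite -FE.
    by have [_ ->] := Fxs; exact: HT.
  by rewrite -FE lerBrDl.
have dist0 e : 0 < e ->
    \forall t \near +oo, (edist_inf (ED_solutions f Pm PM Pl) (P t) <= e%:E)%E.
  move=> e0; have [eta eta0 Heta] := near_ED_solutions f_ge0 f_convex
    f_derivable eps_gt0 feasible_nonempty eps_small xs_opt e0.
  near=> t; have [||y Oy Py] := Heta (P t).
  - by rewrite lerBlDl; near: t; exact: descent.
  - by near: t; exact: balance.
  apply: (@le_trans _ _ (edist (P t, y))).
    by apply: ereal_inf_lbound; exists y.
  by apply: edist_fin => //=; rewrite mx_norm_ball.
apply/fine_cvgP; split.
  near=> t; rewrite ge0_fin_numE ?edist_inf_ge0//.
  by apply: (@le_lt_trans _ _ 1%:E); [near: t; exact: dist0|exact: ltry].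
apply/cvgrPdist_le => e e0; near=> t; rewrite sub0r normrN /=.
have te : (edist_inf (ED_solutions f Pm PM Pl) (P t) <= e%:E)%E.
  by near: t; exact: dist0.
rewrite ger0_norm ?fine_ge0 ?edist_inf_ge0// -lee_fin fineK//.
rewrite ge0_fin_numE ?edist_inf_ge0//.
exact: le_lt_trans te (ltry e).
Unshelve. all: end_near. Qed.
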